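(* Let $\mathcal{F}=((X,d),(f_i)_{i\in I})$ be a generalized possibly infinite iterated function system of order $m\in\mathbb{N}^*$ such that $I$ is finite and all the functions $f_i$, $i\in I$, are contractive. Then the operator $H_{\mathcal{F}}:\mathcal{C}^m\to\mathcal{C}$ is contractive.
   Context: $\mathbb{N}^{*}=\{1,2,\dots\}$. The sets $X$ and $I$ are nonempty. For a metric space $(Y,\rho)$ and $m\in\mathbb{N}^*$, $Y^m$ carries the maximum metric $\rho_{\max}((x_1,\dots,x_m),(y_1,\dots,y_m))=\max_j \rho(x_j,y_j)$. A map $f:Y^m\to Y$ is contractive if $\rho(f(x),f(y))<\rho_{\max}(x,y)$ for all $x,y\in Y^m$ with $x\ne y$. A generalized possibly infinite iterated function system of order $m$ is a pair $\mathcal{F}=((X,d),(f_i)_{i\in I})$, where $(X,d)$ is a metric space, each $f_i:X^m\to X$ is continuous, and the family $(f_i)_{i\in I}$ is bounded, i.e. $\bigcup_{i\in I}f_i(B)$ is bounded for every bounded $B\subseteq X^m$. Code space: $\Omega_1=I$, $\Omega_{k+1}=\Omega_k\times\dots\times\Omega_k$ ($m$ times), and $\Omega=\Omega_1\times\Omega_2\times\cdots$. Elements of $\Omega$ are written $\alpha=\alpha^1\alpha^2\dots\alpha^k\dots$ with $\alpha^k\in\Omega_k$; for $k\ge2$ write $\alpha^k=\alpha^k_1\alpha^k_2\dots\alpha^k_m$ with $\alpha^k_i\in\Omega_{k-1}$, and for $i\in\{1,\dots,m\}$ put $\alpha(i)=\alpha^2_i\alpha^3_i\alpha^4_i\dots\in\Omega$.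 $\Omega$ is endowed with the metric $d(\alpha,\beta)=\sum_{k\ge1}c^k\,\delta(\alpha^k,\beta^k)$, where $c\in(0,1)$ is fixed and $\delta(\alpha^k,\beta^k)$ is $1$ if $\alpha^k\neq\beta^k$ and $0$ otherwise. $\mathcal{C}$ is the set of continuous bounded functions $f:\Omega\to X$ with the metric $d_u(f,g)=\sup_{\alpha\in\Omega}d(f(\alpha),g(\alpha))$; $\mathcal{C}^m$ carries the corresponding maximum metric. The operator $H_{\mathcal{F}}:\mathcal{C}^m\to\mathcal{C}$ is $H_{\mathcal{F}}(g_1,\dots,g_m)(\alpha)=f_{\alpha^1}(g_1(\alpha(1)),\dots,g_m(\alpha(m)))$ for $\alpha=\alpha^1\alpha^2\dots\in\Omega$. *)

(* Defs.v *)
From HB Require Import structures.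
From mathcomp Require Import all_boot all_order all_algebra.
From mathcomp Require Import all_classical all_reals all_analysis.
Set Implicit Arguments.
Unset Strict Implicit.
Unset Printing Implicit Defensive.
Import Order.TTheory GRing.Theory Num.Theory.
Import numFieldNormedType.Exports.
Local Open Scope classical_set_scope.
Local Open Scope ring_scope.

Lemma continuous_mdistP {R : realType} {Y Z : metricType R} (f : Y -> Z) (x : Y) :
  {for x, continuous f} <-> forall e, 0 < e -> exists2 d, 0 < d &
    forall y, mdist x y < d -> mdist (f x) (f y) < e.
Proof.
split => [/metricType_numDomainType.cvgrPdist_lt fx e /fx|fx].
  by move/metricType_numDomainType.nbhs_mdistP.
apply/metricType_numDomainType.cvgrPdist_lt => e /fx.
by move/metricType_numDomainType.nbhs_mdistP.
Qed.

Section maximum_metric.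
Context {R : realType} (m : nat) (Y : metricType R).
Implicit Types x y z : {ffun 'I_m -> Y}.

Definition max_dist x y : R := \big[Order.max/0]_(j < m) mdist (x j) (y j).

Lemma le_max_dist x y j : mdist (x j) (y j) <= max_dist x y.
Proof. exact: le_bigmax. Qed.

Lemma max_dist_le x y e : 0 <= e -> (forall j, mdist (x j) (y j) <= e) ->
  max_dist x y <= e.
Proof. by move=> e0 h; apply: bigmax_le. Qed.

Lemma max_dist_ge0 x y : 0 <= max_dist x y.
Proof. exact: bigmax_ge_id. Qed.

Lemma max_distxx x : max_dist x x = 0.
Proof.
by apply/eqP; rewrite eq_le max_dist_ge0 max_dist_le// => j; rewrite mdistxx.
Qed.

Lemma max_dist_eq0 x y : max_dist x y = 0 -> x = y.
Proof.
move=> h; apply/ffunP => j; apply: mdist_positivity.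
by apply/eqP; rewrite eq_le mdist_ge0 -h le_max_dist.
Qed.

Lemma max_dist_sym x y : max_dist x y = max_dist y x.
Proof. by apply: eq_bigr => j _; rewrite metric_sym. Qed.

Lemma max_dist_triangle y x z : max_dist x z <= max_dist x y + max_dist y z.
Proof.
apply: max_dist_le => [|j]; first by rewrite addr_ge0// max_dist_ge0.
by rewrite (le_trans (metric_triangle _ (y j) _))// lerD// le_max_dist.
Qed.

HB.instance Definition _ := isMetric.Build R {ffun 'I_m -> Y}
  max_distxx max_dist_eq0 max_dist_sym max_dist_triangle.

Lemma mdist_ffunE x y : mdist x y = max_dist x y. Proof. by []. Qed.

End maximum_metric.

Definition contractive {R : realType} {m : nat} {Y : metricType R}
    (f : {ffun 'I_m -> Y} -> Y) : Prop :=
  forall x y, x <> y -> mdist (f x) (f y) < mdist x y.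

Definition metric_bounded {R : realType} {Y : metricType R} (A : set Y) : Prop :=
  exists M : R, forall x y, A x -> A y -> mdist x y <= M.

Record giifs {R : realType} (m : nat) (X : metricType R) (I : Type) := Giifs {
  giifs_fun :> I -> {ffun 'I_m -> X} -> X ;
  giifs_continuous : forall i, continuous (giifs_fun i) ;
  giifs_bounded : forall B : set {ffun 'I_m -> X}, metric_bounded B ->
    metric_bounded (\bigcup_i (giifs_fun i @` B))
}.

(* Levels are counted from 0: [level m I k] is $\Omega_{k+1}$. *)
Fixpoint level (m : nat) (I : Type) (k : nat) : Type :=
  if k is k'.+1 then {ffun 'I_m -> level m I k'} else I.

(* The ratio c is a parameter of the type so that the metric can depend on it. *)
Definition code {R : realType} {c : R} (hc : 0 < c < 1) (m : nat) (I : Type) :=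
  forall k, level m I k.

Section code_space.
Context {R : realType} {c : R} (hc : 0 < c < 1) (m : nat) (I : Type).
Implicit Types a b : code hc m I.

HB.instance Definition _ := gen_eqMixin (code hc m I).
HB.instance Definition _ := gen_choiceMixin (code hc m I).

Definition discr {T : Type} (s t : T) : R := if `[< s = t >] then 0 else 1.

(* The exponent is k+1 because the term of index k compares elements of
   $\Omega_{k+1}$. *)
Definition code_dist_term a b : R^nat :=
  fun k => c ^+ k.+1 * discr (a k) (b k).

Definition code_dist a b : R := limn (series (code_dist_term a b)).

(* $\alpha(j) = \alpha^2_j\alpha^3_j\alpha^4_j\dots$ *)
Definition code_proj (j : 'I_m) a : code hc m I :=
  fun k => (a k.+1 : {ffun 'I_m -> level m I k}) j.

Let c0 : 0 < c. Proof. by case/andP: hc. Qed.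
Let c1 : c < 1. Proof. by case/andP: hc. Qed.

Lemma discr_ge0 T (s t : T) : 0 <= discr s t.
Proof. by rewrite /discr; case: ifP. Qed.

Lemma discr_le1 T (s t : T) : discr s t <= 1.
Proof. by rewrite /discr; case: ifP. Qed.

Lemma discrxx T (s : T) : discr s s = 0.
Proof. by rewrite /discr; case: ifPn => // /asboolPn. Qed.

Lemma discr_neq T (s t : T) : s <> t -> discr s t = 1.
Proof. by rewrite /discr => st; case: ifPn => // /asboolP. Qed.

Lemma discr_sym T (s t : T) : discr s t = discr t s.
Proof.
have [->//|st] := pselect (s = t).
by rewrite !discr_neq// => ts; apply: st.
Qed.

Lemma discr_triangle T (t s u : T) : discr s u <= discr s t + discr t u.
Proof.
have [->|st] := pselect (s = t); first by rewrite discrxx add0r.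
by rewrite (discr_neq st) (le_trans (discr_le1 _ _))// lerDl discr_ge0.
Qed.

Lemma code_dist_term_ge0 a b k : 0 <= code_dist_term a b k.
Proof. by rewrite mulr_ge0 ?discr_ge0// exprn_ge0// ltW. Qed.

Lemma is_cvg_code_dist a b : cvgn (series (code_dist_term a b)).
Proof.
apply: (@series_le_cvg _ _ (geometric c c)).
- exact: code_dist_term_ge0.
- by move=> k; rewrite /geometric /= mulr_ge0 ?exprn_ge0// ltW.
- move=> k; rewrite /geometric /= -exprS ler_piMr ?discr_le1//.
  by rewrite exprn_ge0// ltW.
- by apply: is_cvg_geometric_series; rewrite ger0_norm// ltW.
Qed.

Lemma code_dist_partial a b n : series (code_dist_term a b) n <= code_dist a b.
Proof.
apply: nondecreasing_cvgn_le; last exact: is_cvg_code_dist.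
by apply: nondecreasing_series => k _ _; exact: code_dist_term_ge0.
Qed.

Lemma code_dist_le a b e :
  (forall n, series (code_dist_term a b) n <= e) -> code_dist a b <= e.
Proof.
move=> h; apply: limr_le; first exact: is_cvg_code_dist.
by apply: nearW.
Qed.

Lemma code_dist_term_le a b k : code_dist_term a b k <= code_dist a b.
Proof.
apply: le_trans (code_dist_partial a b k.+1).
rewrite /series /= big_nat_recr//= lerDr sumr_ge0// => i _.
exact: code_dist_term_ge0.
Qed.

Lemma code_dist_ge0 a b : 0 <= code_dist a b.
Proof. by apply: le_trans (code_dist_term_le a b 0%N); exact: code_dist_term_ge0. Qed.

Lemma code_distxx a : code_dist a a = 0.
Proof.
apply/eqP; rewrite eq_le code_dist_ge0 andbT; apply: code_dist_le => n.
by rewrite /series /= big1// => k _; rewrite /code_dist_term discrxx mulr0.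
Qed.

Lemma code_dist_eq0 a b : code_dist a b = 0 -> a = b.
Proof.
move=> h; apply: functional_extensionality_dep => k.
apply: contrapT => abk; have := code_dist_term_le a b k.
by rewrite h /code_dist_term discr_neq// mulr1 leNgt exprn_gt0.
Qed.

Lemma code_dist_sym a b : code_dist a b = code_dist b a.
Proof.
rewrite /code_dist; suff -> : code_dist_term a b = code_dist_term b a by [].
by apply/funext => k; rewrite /code_dist_term discr_sym.
Qed.

Lemma code_dist_triangle b a d : code_dist a d <= code_dist a b + code_dist b d.
Proof.
apply: code_dist_le => n.
apply: le_trans (lerD (code_dist_partial a b n) (code_dist_partial b d n)).
rewrite /series /= -big_split /=; apply: ler_sum => k _.
by rewrite -mulrDr ler_wpM2l ?discr_triangle// exprn_ge0// ltW.
Qed.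

HB.instance Definition _ := isMetric.Build R (code hc m I)
  code_distxx code_dist_eq0 code_dist_sym code_dist_triangle.

Lemma mdist_codeE a b : mdist a b = code_dist a b. Proof. by []. Qed.

Lemma code_head_eq a b : mdist a b < c -> a 0%N = b 0%N.
Proof.
move=> abc; apply: contrapT => ab0; have := code_dist_term_le a b 0%N.
by rewrite /code_dist_term discr_neq// mulr1 expr1 leNgt => /negP; apply.
Qed.

Lemma code_proj_dist j a b :
  c * mdist (code_proj j a) (code_proj j b) <= mdist a b.
Proof.
rewrite mulrC -ler_pdivlMr//; apply: code_dist_le => n.
rewrite ler_pdivlMr// mulrC; apply: le_trans (code_dist_partial a b n.+1).
rewrite /series /= mulr_sumr big_nat_recl//= -[leLHS]add0r lerD//.
  exact: code_dist_term_ge0.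
apply: ler_sum => k _; rewrite /code_dist_term mulrA -exprS.
apply: ler_wpM2l; first by rewrite exprn_ge0// ltW.
have [abk|abk] := pselect (a k.+1 = b k.+1).
  by rewrite /code_proj abk !discrxx.
by rewrite (discr_neq abk) discr_le1.
Qed.

End code_space.

Section bounded_continuous_functions.
Context {R : realType} (T : topologicalType) (X : metricType R).

Record bcfun := BCFun {
  bcfun_fun :> T -> X ;
  bcfun_continuous : continuous bcfun_fun ;
  bcfun_bounded : metric_bounded (range bcfun_fun)
}.

HB.instance Definition _ := gen_eqMixin bcfun.
HB.instance Definition _ := gen_choiceMixin bcfun.

Implicit Types f g h : bcfun.

Definition sup_dist f g : R := sup (range (fun t => mdist (f t) (g t))).

Lemma bcfun_eq f g : (forall t, f t = g t) -> f = g.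
Proof.
case: f g => [f fc fb] [g gc gb] /= /funext fg.
by subst g; congr BCFun; exact: Prop_irrelevance.
Qed.

Lemma has_ubound_bcfun f g : has_ubound (range (fun t => mdist (f t) (g t))).
Proof.
have [M fM] := bcfun_bounded f; have [N gN] := bcfun_bounded g.
have [[t0 _]|noT] := pselect (exists t : T, True); last first.
  by exists 0 => ? [t _ _]; case: noT; exists t.
exists (M + (mdist (f t0) (g t0) + N)) => _ [t _ <-].
rewrite (le_trans (metric_triangle _ (f t0) _))// lerD//.
  by apply: fM; [exists t|exists t0].
rewrite (le_trans (metric_triangle _ (g t0) _))// lerD//.
by apply: gN; [exists t0|exists t].
Qed.

Lemma le_sup_dist f g t : mdist (f t) (g t) <= sup_dist f g.
Proof. by apply: ub_le_sup; [exact: has_ubound_bcfun|exists t]. Qed.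

Lemma sup_dist_le f g e : 0 <= e -> (forall t, mdist (f t) (g t) <= e) ->
  sup_dist f g <= e.
Proof.
move=> e0 fge; rewrite /sup_dist.
have [->|/set0P ne] := eqVneq (range (fun t => mdist (f t) (g t))) set0.
  by rewrite sup0.
by apply: ge_sup => // _ [t _ <-].
Qed.

Lemma sup_dist_ge0 f g : 0 <= sup_dist f g.
Proof.
have [[t _]|noT] := pselect (exists t : T, True).
  by rewrite (le_trans _ (le_sup_dist f g t))// mdist_ge0.
rewrite /sup_dist sup_out// => -[[x [t _ _]] _].
by apply: noT; exists t.
Qed.

Lemma sup_distxx f : sup_dist f f = 0.
Proof.
by apply/eqP; rewrite eq_le sup_dist_ge0 sup_dist_le// => t; rewrite mdistxx.
Qed.

Lemma sup_dist_eq0 f g : sup_dist f g = 0 -> f = g.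
Proof.
move=> fg; apply: bcfun_eq => t; apply: mdist_positivity.
by apply/eqP; rewrite eq_le mdist_ge0 -fg le_sup_dist.
Qed.

Lemma sup_dist_sym f g : sup_dist f g = sup_dist g f.
Proof.
rewrite /sup_dist; under eq_fun do rewrite metric_sym.
by [].
Qed.

Lemma sup_dist_triangle g f h : sup_dist f h <= sup_dist f g + sup_dist g h.
Proof.
apply: sup_dist_le => [|t]; first by rewrite addr_ge0// sup_dist_ge0.
by rewrite (le_trans (metric_triangle _ (g t) _))// lerD// le_sup_dist.
Qed.

HB.instance Definition _ := isMetric.Build R bcfun
  sup_distxx sup_dist_eq0 sup_dist_sym sup_dist_triangle.

Lemma mdist_bcfunE f g : mdist f g = sup_dist f g. Proof. by []. Qed.

End bounded_continuous_functions.

Section operator.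
Context {R : realType} {c : R} (hc : 0 < c < 1) {m : nat} {X : metricType R}
  {I : Type} (F : giifs m X I).
Local Notation Omega := (code hc m I).
Local Notation C := (bcfun Omega X).
Implicit Type g : {ffun 'I_m -> C}.

Definition giifs_op_fun g (a : Omega) : X :=
  F (a 0%N) [ffun j => g j (code_proj j a)].

Lemma giifs_op_continuous g : continuous (giifs_op_fun g).
Proof.
have c0 : 0 < c by case/andP: hc.
move=> a; apply/continuous_mdistP => e e0.
have /continuous_mdistP/(_ e e0)[d d0 dF] :=
  @giifs_continuous _ _ _ _ F (a 0%N) [ffun j => g j (code_proj j a)].
have /choice[r gr] j : exists r, 0 < r /\ forall b,
    mdist (code_proj j a) b < r -> mdist (g j (code_proj j a)) (g j b) < d.
  have /continuous_mdistP/(_ d d0)[r r0 rg] :=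
    @bcfun_continuous _ _ _ (g j) (code_proj j a).
  by exists r.
exists (\big[Order.min/c]_(j < m) (c * r j)).
  by apply: lt_bigmin => // j _; rewrite mulr_gt0// (gr j).1.
move=> b ab; rewrite /giifs_op_fun.
have <- : a 0%N = b 0%N.
  by apply: (@code_head_eq _ _ hc); apply: lt_le_trans ab (bigmin_le_id _ _ _ _).
apply: dF; apply: bigmax_lt => // j _; rewrite !ffunE.
apply: (gr j).2; rewrite -(ltr_pM2l c0).
apply: le_lt_trans (code_proj_dist _ _ _) _.
exact: lt_le_trans ab (bigmin_le _ _ _).
Qed.

Lemma giifs_op_bounded g : metric_bounded (range (giifs_op_fun g)).
Proof.
pose B := [set x | exists a : Omega, x = [ffun j => g j (code_proj j a)]].
have bB : metric_bounded B.
  have /choice[M gM] j := bcfun_bounded (g j).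
  exists (\big[Order.max/0]_(j < m) M j) => _ _ [a ->] [b ->].
  apply: max_dist_le => [|j]; first exact: bigmax_ge_id.
  rewrite !ffunE (le_trans _ (le_bigmax _ _ j))//.
  by apply: gM; [exists (code_proj j a)|exists (code_proj j b)].
have [M FM] := giifs_bounded F bB.
by exists M => _ _ [a _ <-] [b _ <-]; apply: FM;
  [exists (a 0%N)|exists (b 0%N)] => //; eexists => //;
  [exists a|exists b].
Qed.

Definition giifs_op g : C := BCFun (@giifs_op_continuous g) (@giifs_op_bounded g).

Lemma giifs_opE g (a : Omega) :
  giifs_op g a = F (a 0%N) [ffun j => g j (code_proj j a)].
Proof. by []. Qed.

End operator.

Arguments giifs_op {R c} hc {m X I} F g.

(* Main.v *)
Require Import Defs.
From HB Require Import structures.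
From mathcomp Require Import all_boot all_order all_algebra.
From mathcomp Require Import all_classical all_reals all_analysis.
From mathcomp Require Import lra.
Import Order.TTheory GRing.Theory Num.Theory.
Import numFieldNormedType.Exports.
Local Open Scope classical_set_scope.
Local Open Scope ring_scope.

(** For a single code [a], contractivity of the map [F (a 0%N)] shows that the
    images under the operator of two distinct tuples [x] and [y] are at a
    distance less than [mdist x y] at [a]. Taking the supremum over [a] could
    turn this strict inequality into an equality, so the point is that the
    supremum is attained: the code space is compact when the index set is
    finite ([code_compact]) and the distance between two continuous functions
    is a continuous function ([continuous_mdist2]).

    Compactness is proved with ultrafilters. Every level of the code space is
    finite, so an ultrafilter on codes decides each letter: for each [k] exactly
    one value of the [k]-th letter is taken on a set of the ultrafilter
    ([ultra_finite_fiber]). The code made of these values is a limit, since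
    codes that agree on their first [n] letters are close
    ([code_dist_agree]). *)

Lemma finite_setT_surj (V : Type) : finite_set [set: V] ->
  exists (J : finType) (e : J -> V), forall v, exists j, e j = v.
Proof.
move=> /(@finite_seqP {classic V})[s Vs].
exists (seq_sub s), (fun j : seq_sub s => ssval j : V) => v.
have vs : (v : {classic V}) \in s.
  by have : [set: {classic V}] v by []; rewrite Vs.
by exists (SeqSub vs).
Qed.

Lemma finite_level (m : nat) (I : Type) (k : nat) :
  finite_set [set: I] -> finite_set [set: level m I k].
Proof.
move=> finI; elim: k => [//|k /finite_setT_surj[J [e esurj]]] /=.
pose h (u : {ffun 'I_m -> J}) : level m I k.+1 := [ffun i => e (u i)].
rewrite (_ : [set: _] = range h); first exact/finite_image/finite_finset.
apply/esym; rewrite -subTset => v _.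
have /choice[u uv] i := esurj (v i).
by exists (finfun u) => //; apply/ffunP => i; rewrite !ffunE uv.
Qed.

(** Otherwise the complements of the finitely many fibers would all belong to
    the ultrafilter, and so would their empty intersection. *)
Lemma ultra_finite_fiber (T V : Type) (h : T -> V) (G : set_system T) :
  UltraFilter G -> finite_set [set: V] -> exists v, G [set t | h t = v].
Proof.
move=> GU /finite_setT_surj[J [e esurj]]; apply: contrapT => noV.
have GC j : G [set t | h t <> e j].
  have [Gj|//] := in_ultra_setVsetC [set t | h t = e j] GU.
  by case: noV; exists (e j).
have [t ht] := filter_ex (filter_forall _ GC).
by have [j ej] := esurj (h t); exact: (ht j).
Qed.

(** The distance is at most the tail of a geometric series. *)
Lemma code_dist_agree {R : realType} {c : R} (hc : 0 < c < 1) (m : nat)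
    (I : Type) (a b : Defs.code hc m I) (n : nat) :
  (forall k, (k < n)%N -> a k = b k) -> mdist a b <= c ^+ n.+1 / (1 - c).
Proof.
have /andP[c0 c1] := hc; move=> ab.
have c1' : 0 < 1 - c by rewrite subr_gt0.
apply: code_dist_le => N; rewrite ler_pdivlMr//.
(* The sharper bound below telescopes in [N]. *)
suff : series (code_dist_term a b) N * (1 - c)
    <= c ^+ n.+1 - c ^+ (maxn n N).+1.
  by move/le_trans; apply; rewrite gerBl exprn_ge0// ltW.
elim: N => [|N IH]; first by rewrite /series /= big_geq// mul0r maxn0 subrr.
rewrite /series /= big_nat_recr//= mulrDl.
have [Nn|nN] := ltnP N n.
  rewrite {2}/code_dist_term ab// discrxx mulr0 mul0r addr0.
  by move: IH; rewrite !(maxn_idPl _)// ltnW.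
move: IH; rewrite (maxn_idPr nN) (maxn_idPr (leqW nN)) => IH.
apply: (@le_trans _ _ (c ^+ n.+1 - c ^+ N.+1 + c ^+ N.+1 * (1 - c))).
  apply: lerD => //; rewrite ler_pM2r// ler_piMr ?discr_le1//.
  by rewrite exprn_ge0// ltW.
by rewrite mulrBr mulr1 -exprSr addrA subrK.
Qed.

Lemma code_compact {R : realType} {c : R} (hc : 0 < c < 1) (m : nat)
    (I : Type) : finite_set [set: I] -> compact [set: Defs.code hc m I].
Proof.
have /andP[c0 c1] := hc; move=> finI; rewrite compact_ultra => G GU _.
have Gletter k : exists v : level m I k, G [set b : Defs.code hc m I | b k = v].
  by apply: ultra_finite_fiber; exact: finite_level.
pose a k := sval (cid (Gletter k)).
have Ga k : G [set b : Defs.code hc m I | b k = a k] := svalP (cid (Gletter k)).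
exists (a : Defs.code hc m I); split => // A.
move=> /metricType_numDomainType.nbhs_mdistP[e /= e0 aeA].
have c1' : 0 < 1 - c by rewrite subr_gt0.
have [n cn] : exists n, c ^+ n.+1 / (1 - c) < e.
  have : c ^+ n @[n --> \oo] --> 0 by apply: cvg_expr; rewrite gtr0_norm.
  move=> /cvgrPdist_lt/(_ (e * (1 - c)) (mulr_gt0 e0 c1'))[n _ /(_ n.+1)].
  move=> /(_ (leqnSn n)); rewrite /= sub0r normrN gtr0_norm ?exprn_gt0// => h.
  by exists n; rewrite ltr_pdivrMr.
apply: filterS (filter_forall _ (fun k : 'I_n => Ga k)) => b ab.
apply: aeA; apply: le_lt_trans cn.
by apply: code_dist_agree => k kn; rewrite (ab (Ordinal kn)).
Qed.

Lemma continuous_mdist2 {R : realType} {T Y : metricType R} (u v : T -> Y) :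
  continuous u -> continuous v -> continuous (fun t => mdist (u t) (v t)).
Proof.
move=> uc vc t; apply/cvgrPdist_lt => e e0.
have e20 : 0 < e / 2 by rewrite divr_gt0.
have /metricType_numDomainType.cvgrPdist_lt/(_ _ e20) := uc t.
have /metricType_numDomainType.cvgrPdist_lt/(_ _ e20) := vc t.
apply: filterS2 => s vs us.
rewrite [e]splitr; apply: le_lt_trans (ltrD us vs).
have h1 := metric_triangle (u t) (u s) (v t).
have h2 := metric_triangle (u s) (v s) (v t).
have h3 := metric_triangle (u s) (u t) (v s).
have h4 := metric_triangle (u t) (v t) (v s).
rewrite (metric_sym (v s) (v t)) in h2; rewrite (metric_sym (u s) (u t)) in h3.
by rewrite ler_norml; apply/andP; split; lra.
Qed.

Theorem proposition3p8 (R : realType) (c : R) (hc : 0 < c < 1)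
    (m : nat) (hm : (0 < m)%N) (X : metricType R) (hX : [set: X] !=set0)
    (I : Type) (hI : [set: I] !=set0) (F : giifs m X I)
    (hfin : finite_set [set: I]) (hF : forall i : I, contractive (F i)) :
  contractive (giifs_op hc F).
Proof.
move=> x y xy.
have xy0 : 0 < mdist x y.
  rewrite lt_neqAle mdist_ge0 andbT eq_sym; apply/eqP => /mdist_positivity.
  exact: xy.
(* Distinct tuples take different values at some code. *)
have [a1 _] : [set: Defs.code hc m I] !=set0.
  apply: contrapT => no; apply: xy; apply/ffunP => j; apply: bcfun_eq => t.
  by case: no; exists t.
pose phi (a : Defs.code hc m I) := mdist (giifs_op hc F x a) (giifs_op hc F y a).
have phic : continuous phi.
  by apply: continuous_mdist2; exact: bcfun_continuous.
have [a _ amax] : exists2 a, a \in [set: Defs.code hc m I] &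
    forall b, b \in [set: Defs.code hc m I] -> phi b <= phi a.
  apply: compact_EVT_max; [by exists a1|exact: code_compact|].
  exact: continuous_subspaceT.
apply: (@le_lt_trans _ _ (phi a)).
  by apply: sup_dist_le => [|b]; [exact: mdist_ge0|apply: amax; rewrite inE].
rewrite /phi !giifs_opE.
set u := [ffun j => x j _]; set v := [ffun j => y j _].
(* Contractivity applies only to distinct arguments; if [u] and [v] coincide
   then the maximal distance is zero. *)
have [<-|uv] := pselect (u = v); first by rewrite mdistxx.
apply: lt_le_trans (hF _ _ _ uv) _.
apply: max_dist_le => [|j]; first exact: ltW.
rewrite !ffunE; apply: le_trans (le_sup_dist _ _ _) _.
exact: (@le_max_dist R m _ x y j).
Qed.
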